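(* Let $\widehat{\boldsymbol\mu}\in\Gamma$. Then the conditional risk of the constrained estimator $\widehat{\boldsymbol\mu}^{C}(\widehat{\boldsymbol\mu},\mathbf t)$ relative to the loss $L(\boldsymbol\mu,\widehat{\boldsymbol\mu};\mathbf Q)$ satisfies, for every $\boldsymbol\mu$, $$R(\boldsymbol\mu,\widehat{\boldsymbol\mu}^{C}(\widehat{\boldsymbol\mu},\mathbf t))=R_1(\boldsymbol\mu,\widehat{\boldsymbol\mu})+R_2(\boldsymbol\mu,\mathbf t),$$ where $$R_1(\boldsymbol\mu,\widehat{\boldsymbol\mu})=E\big[(\widehat{\boldsymbol\mu}-\boldsymbol\mu)'\mathbf Q(\mathbf I-\mathbf P_{\mathbf W})(\widehat{\boldsymbol\mu}-\boldsymbol\mu)\,\big|\,\boldsymbol\mu\big],$$ $$R_2(\boldsymbol\mu,\mathbf t)=E\big[(\mathbf t(\mathbf y)-\mathbf W'\boldsymbol\mu)'(\mathbf W'\mathbf Q^{-1}\mathbf W)^{-1}(\mathbf t(\mathbf y)-\mathbf W'\boldsymbol\mu)\,\big|\,\boldsymbol\mu\big].$$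
   Context: Model: $\mathbf y=\boldsymbol\mu+\boldsymbol\epsilon$, where $\mathbf y,\boldsymbol\mu,\boldsymbol\epsilon\in\mathbb R^k$, $\boldsymbol\mu$ is an unknown mean vector and $\boldsymbol\epsilon$ is a random error vector (normality is not assumed). $E[\cdot\,|\,\boldsymbol\mu]$ is expectation over $\mathbf y$ for given $\boldsymbol\mu$. $\mathbf Q$ is a fixed $k\times k$ (symmetric) positive definite matrix; $\mathbf W$ is a fixed $k\times m$ matrix of rank $m$, $m<k$; $\mathbf t=\mathbf t(\mathbf y)$ is a given function from $\mathbb R^k$ to $\mathbb R^m$, with finite second moments given $\boldsymbol\mu$. The benchmark constraint is $\mathbf W'\widehat{\boldsymbol\mu}=\mathbf t(\mathbf y)$. $\Gamma$ is the class of estimators $\widehat{\boldsymbol\mu}=\widehat{\boldsymbol\mu}(\mathbf y)$ of $\boldsymbol\mu$ with $E[\widehat{\boldsymbol\mu}'\widehat{\boldsymbol\mu}\,|\,\boldsymbol\mu]<\infty$. For a matrix $\mathbf M$, $L(\boldsymbol\mu,\widehat{\boldsymbol\mu};\mathbf M)=(\widehat{\boldsymbol\mu}-\boldsymbol\mu)'\mathbf M(\widehat{\boldsymbol\mu}-\boldsymbol\mu)$, and $R(\boldsymbol\mu,\widehat{\boldsymbol\mu})=E[L(\boldsymbol\mu,\widehat{\boldsymbol\mu};\mathbf Q)\,|\,\boldsymbol\mu]$. The constrained estimator based on $\widehat{\boldsymbol\mu}$ is $$\widehat{\boldsymbol\mu}^{C}(\widehat{\boldsymbol\mu},\mathbf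 t)=\widehat{\boldsymbol\mu}+\mathbf Q^{-1}\mathbf W(\mathbf W'\mathbf Q^{-1}\mathbf W)^{-1}\{\mathbf t(\mathbf y)-\mathbf W'\widehat{\boldsymbol\mu}\},$$ and $\mathbf P_{\mathbf W}=\mathbf Q^{-1}\mathbf W(\mathbf W'\mathbf Q^{-1}\mathbf W)^{-1}\mathbf W'$. *)

(* Defs.v *)
From HB Require Import structures.
From mathcomp Require Import all_boot all_order all_algebra.
From mathcomp Require Import all_classical all_reals all_analysis.

Set Implicit Arguments.
Unset Strict Implicit.
Unset Printing Implicit Defensive.

Import Order.TTheory GRing.Theory Num.Theory.
Import numFieldNormedType.Exports.

Local Open Scope classical_set_scope.
Local Open Scope ring_scope.

(* R^n with its Borel sigma-algebra; MathComp-Analysis puts a topology, but no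
   measurable structure, on matrices. The alias is convertible to 'cV[R]_n. *)
Definition borel_vector (R : realType) (n : nat) :=
  g_sigma_algebraType (@open 'cV[R]_n).

Definition random_vector (R : realType) (n : nat) (d : measure_display)
    (Omega : measurableType d) (X : Omega -> 'cV[R]_n) : Prop :=
  measurable_fun [set: Omega] (X : Omega -> borel_vector R n).

Definition borel_fun (R : realType) (k n : nat) (f : 'cV[R]_k -> 'cV[R]_n)
    : Prop :=
  measurable_fun [set: borel_vector R k]
    (f : borel_vector R k -> borel_vector R n).

(* u' M u; the product is a 1 x 1 matrix. *)
Definition quadratic_form (R : realType) (n : nat) (M : 'M[R]_n) (u : 'cV[R]_n)
    : R :=
  (u^T *m M *m u) 0 0.

Definition symmetric_posdef (R : realType) (n : nat) (M : 'M[R]_n) : Prop :=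
  M^T = M /\ forall u : 'cV[R]_n, u != 0 -> 0 < quadratic_form M u.

(* E[f(y) | mu] in the model y = mu + eps, where [P mu] is the probability
   given the mean vector mu, so that the law of eps may depend on mu. *)
Definition cond_expectation (R : realType) (k : nat) (d : measure_display)
    (Omega : measurableType d) (P : 'cV[R]_k -> probability Omega R)
    (eps : Omega -> 'cV[R]_k) (f : 'cV[R]_k -> R) (mu : 'cV[R]_k) : \bar R :=
  expectation (P mu) (fun w => f (mu + eps w)).

Definition finite_second_moments (R : realType) (k n : nat)
    (d : measure_display) (Omega : measurableType d)
    (P : 'cV[R]_k -> probability Omega R) (eps : Omega -> 'cV[R]_k)
    (f : 'cV[R]_k -> 'cV[R]_n) : Prop :=
  forall (mu : 'cV[R]_k) (i : 'I_n),
    (cond_expectation P eps (fun y => f y i ord0 ^+ 2)%R mu < +oo)%E.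

Definition Gamma (R : realType) (k : nat) (d : measure_display)
    (Omega : measurableType d) (P : 'cV[R]_k -> probability Omega R)
    (eps : Omega -> 'cV[R]_k) (muhat : 'cV[R]_k -> 'cV[R]_k) : Prop :=
  borel_fun muhat /\
  forall mu : 'cV[R]_k,
    (cond_expectation P eps (fun y => ((muhat y)^T *m muhat y) 0 0)%R mu
     < +oo)%E.

Definition loss (R : realType) (k : nat) (mu a : 'cV[R]_k) (M : 'M[R]_k) : R :=
  quadratic_form M (a - mu).

Definition risk (R : realType) (k : nat) (d : measure_display)
    (Omega : measurableType d) (P : 'cV[R]_k -> probability Omega R)
    (eps : Omega -> 'cV[R]_k) (Q : 'M[R]_k) (mu : 'cV[R]_k)
    (muhat : 'cV[R]_k -> 'cV[R]_k) : \bar R :=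
  cond_expectation P eps (fun y => loss mu (muhat y) Q) mu.

Definition constrained_estimator (R : realType) (k m : nat) (Q : 'M[R]_k)
    (W : 'M[R]_(k, m)) (muhat : 'cV[R]_k -> 'cV[R]_k)
    (t : 'cV[R]_k -> 'cV[R]_m) : 'cV[R]_k -> 'cV[R]_k :=
  fun y => muhat y + invmx Q *m W *m invmx (W^T *m invmx Q *m W)
                       *m (t y - W^T *m muhat y).

Definition proj_mx_W (R : realType) (k m : nat) (Q : 'M[R]_k)
    (W : 'M[R]_(k, m)) : 'M[R]_k :=
  invmx Q *m W *m invmx (W^T *m invmx Q *m W) *m W^T.

Definition risk1 (R : realType) (k m : nat) (d : measure_display)
    (Omega : measurableType d) (P : 'cV[R]_k -> probability Omega R)
    (eps : Omega -> 'cV[R]_k) (Q : 'M[R]_k) (W : 'M[R]_(k, m))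
    (mu : 'cV[R]_k) (muhat : 'cV[R]_k -> 'cV[R]_k) : \bar R :=
  cond_expectation P eps
    (fun y => quadratic_form (Q *m (1%:M - proj_mx_W Q W)) (muhat y - mu)) mu.

Definition risk2 (R : realType) (k m : nat) (d : measure_display)
    (Omega : measurableType d) (P : 'cV[R]_k -> probability Omega R)
    (eps : Omega -> 'cV[R]_k) (Q : 'M[R]_k) (W : 'M[R]_(k, m))
    (mu : 'cV[R]_k) (t : 'cV[R]_k -> 'cV[R]_m) : \bar R :=
  cond_expectation P eps
    (fun y => quadratic_form (invmx (W^T *m invmx Q *m W))
                (t y - W^T *m mu)) mu.

(* Main.v *)
Require Import Defs.
From HB Require Import structures.
From mathcomp Require Import all_boot all_order all_algebra.
From mathcomp Require Import all_classical all_reals all_analysis.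
From mathcomp Require Import measurable_realfun.

Import Order.TTheory GRing.Theory Num.Theory.
Import numFieldNormedType.Exports.

Local Open Scope classical_set_scope.
Local Open Scope ring_scope.

(** The identity holds pointwise, before any expectation is taken. Put
    [u = muhat y - mu], [s = t y - W^T mu] and
    [B = Q^-1 W (W^T Q^-1 W)^-1] ([constraint_lift]), so that [P_W = B W^T].
    The error of the constrained estimator is [(u - P_W u) + B s]. For the
    inner product defined by [Q], the column space of [B] is the orthogonal
    complement of the kernel of [W^T] ([B^T Q = (W^T Q^-1 W)^-1 W^T]), and
    [W^T B = 1] puts [u - P_W u] in that kernel. Hence Pythagoras ([quadratic_form_orthogonal]) gives

      loss = |u - P_W u|_Q^2 + |B s|_Q^2,

    whose two terms are exactly the integrands of [risk1] and [risk2].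

    Both terms are nonnegative because [Q] is positive definite, so they can be
    integrated separately, with values in the extended reals, as soon as they
    are measurable. A quadratic form is a polynomial in the coordinates of its
    argument, hence it is enough that the coordinates of the Borel functions
    [muhat] and [t], taken at the random point [mu + eps], are measurable. *)

Set Implicit Arguments.
Unset Strict Implicit.

Section BorelVector.
Variables (R : realType) (n : nat).
Context {d : measure_display} {Omega : measurableType d}.

Lemma random_vector_coord (X : Omega -> 'cV[R]_n) (i : 'I_n) :
  random_vector X -> measurable_fun setT (fun w => X w i ord0).
Proof.
move=> mX; apply: (measurability _ (RGenOpens.measurableE R)).
move=> _ [_ [a [b ->] <-]].
have open_slab : open [set v : 'cV[R]_n | (v i ord0) \in `]a, b[].
  have /continuousP/(_ _ (@interval_open R (BRight a) (BLeft b) isT isT)) :=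
    @coord_continuous R n 1 i ord0.
  by [].
exact: mX measurableT _ (sub_sigma_algebra open_slab).
Qed.

Lemma random_vector_shift (a : 'cV[R]_n) (X : Omega -> 'cV[R]_n) :
  random_vector X -> random_vector (fun w => a + X w).
Proof.
move=> mX.
apply: (@measurability _ _ Omega (borel_vector R n) _ _ (@open 'cV[R]_n)) => //.
move=> _ [A oA <-].
have shift_continuous : continuous (fun v : 'cV[R]_n => a + v).
  move=> v; have a_cvg := @cvg_cst 'cV[R]_n a _ _ (nbhs_filter v).
  exact: (@cvgD _ 'cV[R]_n _ _ _ (cst a) id _ _ a_cvg (@cvg_id _ _)).
have open_preimage : open ((fun v : 'cV[R]_n => a + v) @^-1` A).
  by have /continuousP H := shift_continuous; exact: H _ oA.
exact: mX measurableT _ (sub_sigma_algebra open_preimage).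
Qed.

Lemma quadratic_formE (M : 'M[R]_n) (u : 'cV[R]_n) :
  quadratic_form M u = \sum_j (\sum_i u i ord0 * M i j) * u j ord0.
Proof.
rewrite /quadratic_form mxE; apply: eq_bigr => j _; rewrite mxE.
by congr (_ * _); apply: eq_bigr => i _; rewrite mxE.
Qed.

Lemma measurable_quadratic_form (M : 'M[R]_n) (a : 'cV[R]_n)
    (X : Omega -> 'cV[R]_n) :
  random_vector X ->
  measurable_fun setT (fun w => quadratic_form M (X w - a)).
Proof.
move=> mX; under eq_fun do rewrite quadratic_formE.
have mcoord i : measurable_fun setT (fun w => (X w - a) i ord0).
  under eq_fun do rewrite !mxE.
  by apply: measurable_funB => //; exact: random_vector_coord.
apply: measurable_sum => j; apply: measurable_funM => //.
by apply: measurable_sum => i; apply: measurable_funM.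
Qed.

End BorelVector.

Lemma random_vector_comp (R : realType) (k n : nat) (d : measure_display)
    (Omega : measurableType d) (f : 'cV[R]_k -> 'cV[R]_n)
    (X : Omega -> 'cV[R]_k) :
  borel_fun f -> random_vector X -> random_vector (fun w => f (X w)).
Proof. by move=> mf mX; exact: (measurableT_comp mf mX). Qed.

Lemma unitmx_of_inj (R : realType) (n : nat) (M : 'M[R]_n) :
  (forall v : 'cV[R]_n, M *m v = 0 -> v = 0) -> M \in unitmx.
Proof.
move=> inj_M; rewrite -unitmx_tr -row_free_unit; apply: inj_row_free => v vM0.
apply: trmx_inj; rewrite trmx0; apply: inj_M.
by rewrite -[M]trmxK -trmx_mul vM0 trmx0.
Qed.

Section ConstraintGeometry.
Variables (R : realType) (k m : nat) (Q : 'M[R]_k) (W : 'M[R]_(k, m)).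
Hypotheses (hQ : symmetric_posdef Q) (hW : \rank W = m).

Definition constraint_gram := W^T *m invmx Q *m W.
Definition constraint_lift := invmx Q *m W *m invmx constraint_gram.
Local Notation S := constraint_gram.
Local Notation B := constraint_lift.

Lemma proj_mx_WE : proj_mx_W Q W = B *m W^T. Proof. by []. Qed.

Lemma quadratic_form_ge0 (u : 'cV[R]_k) : 0 <= quadratic_form Q u.
Proof.
have [->|/hQ.2/ltW//] := eqVneq u 0.
by rewrite /quadratic_form mulmx0 mxE.
Qed.

Lemma posdef_unitmx : Q \in unitmx.
Proof.
apply: unitmx_of_inj => v Qv0; apply/eqP/negPn/negP => /hQ.2.
by rewrite /quadratic_form -mulmxA Qv0 mulmx0 mxE ltxx.
Qed.

(** If [S v = 0] then [v^T S v], which is the squared [Q]-norm of [Q^-1 W v],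
    vanishes; so [W v = 0], and the columns of [W] are independent. *)
Lemma gram_unitmx : S \in unitmx.
Proof.
have Qu := posdef_unitmx.
apply: unitmx_of_inj => v Sv0.
have Wv0 : W *m v = 0.
  rewrite -[LHS](mulKVmx Qu); set x := invmx Q *m _.
  have [->|/hQ.2] := eqVneq x 0; first by rewrite mulmx0.
  suff -> : quadratic_form Q x = (v^T *m (S *m v)) 0 0.
    by rewrite Sv0 mulmx0 mxE ltxx.
  by rewrite /quadratic_form /x /S !trmx_mul trmx_inv hQ.1 !mulmxA mulmxKV.
have freeW : row_free W^T by rewrite /row_free mxrank_tr hW.
apply: trmx_inj; apply: (row_free_inj freeW).
by rewrite -trmx_mul Wv0 !trmx0 mul0mx.
Qed.

Lemma trmx_constraint_lift : W^T *m B = 1%:M.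
Proof. by rewrite /B !mulmxA mulmxV // gram_unitmx. Qed.

Lemma trmx_lift_mul : B^T *m Q = invmx S *m W^T.
Proof.
rewrite /B !trmx_mul !trmx_inv hQ.1 /S !trmx_mul trmxK trmx_inv hQ.1.
by rewrite !mulmxA mulmxKV // posdef_unitmx.
Qed.

(** This also shows that the quadratic form of [S^-1] is nonnegative. *)
Lemma quadratic_form_lift (s : 'cV[R]_m) :
  quadratic_form Q (B *m s) = quadratic_form (invmx S) s.
Proof.
rewrite /quadratic_form trmx_mul -(mulmxA _ _ Q) trmx_lift_mul.
by rewrite mulmxA -(mulmxA _ _ B) -(mulmxA _ _ B) trmx_constraint_lift mulmx1.
Qed.

(** Pythagoras for the inner product of [Q]: the cross term is
    [s^T B^T Q r = s^T S^-1 (W^T r)]. *)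
Lemma quadratic_form_orthogonal (r : 'cV[R]_k) (s : 'cV[R]_m) :
  W^T *m r = 0 ->
  quadratic_form Q (r + B *m s) =
    quadratic_form Q r + quadratic_form (invmx S) s.
Proof.
move=> Wr0; rewrite -quadratic_form_lift /quadratic_form.
have cross : (B *m s)^T *m Q *m r = 0.
  by rewrite trmx_mul -(mulmxA _ _ Q) trmx_lift_mul -!mulmxA Wr0 !mulmx0.
have cross' : r^T *m Q *m (B *m s) = 0.
  apply: trmx_inj; rewrite trmx0 -cross.
  by rewrite !trmx_mul trmxK hQ.1 mulmxA.
by rewrite [(r + _)^T]linearD /= !mulmxDl !mulmxDr cross cross' addr0 add0r mxE.
Qed.

Lemma trmx_constraint_residual (u : 'cV[R]_k) :
  W^T *m (u - proj_mx_W Q W *m u) = 0.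
Proof.
rewrite proj_mx_WE mulmxBr -(mulmxA B) (mulmxA _ B).
by rewrite trmx_constraint_lift mul1mx subrr.
Qed.

(** [P_W] is the [Q]-orthogonal projection onto the column space of [B], which
    makes [Q (1 - P_W)] equal to [(1 - P_W)^T Q (1 - P_W)]. In this form the
    integrand of [risk1] is visibly nonnegative. *)
Lemma quadratic_form_residual (u : 'cV[R]_k) :
  quadratic_form (Q *m (1%:M - proj_mx_W Q W)) u =
    quadratic_form Q (u - proj_mx_W Q W *m u).
Proof.
set r := u - _.
have Pu_orth : (proj_mx_W Q W *m u)^T *m Q *m r = 0.
  rewrite proj_mx_WE -(mulmxA B) trmx_mul -(mulmxA _ _ Q) trmx_lift_mul.
  by rewrite -!mulmxA trmx_constraint_residual !mulmx0.
rewrite /quadratic_form {1}/r [(u - _)^T]linearB /= !mulmxBl Pu_orth subr0.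
by rewrite -!mulmxA mulmxBl mul1mx.
Qed.

Lemma loss_constrained_estimator (mu : 'cV[R]_k)
    (muhat : 'cV[R]_k -> 'cV[R]_k) (t : 'cV[R]_k -> 'cV[R]_m) (y : 'cV[R]_k) :
  loss mu (constrained_estimator Q W muhat t y) Q =
    quadratic_form (Q *m (1%:M - proj_mx_W Q W)) (muhat y - mu) +
    quadratic_form (invmx S) (t y - W^T *m mu).
Proof.
rewrite quadratic_form_residual -quadratic_form_orthogonal; last first.
  exact: trmx_constraint_residual.
congr (quadratic_form Q _); rewrite proj_mx_WE /constrained_estimator.
have -> : t y - W^T *m muhat y
    = (t y - W^T *m mu) - W^T *m (muhat y - mu).
  by rewrite mulmxBr opprB addrA subrK.
by rewrite mulmxBr addrAC [B *m _ - _]addrC addrA (mulmxA B).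
Qed.

End ConstraintGeometry.

Unset Implicit Arguments.
Set Strict Implicit.

Theorem lemma2p1 (R : realType) (k m : nat) (hmk : (m < k)%N)
    (d : measure_display) (Omega : measurableType d)
    (P : 'cV[R]_k -> probability Omega R)
    (eps : Omega -> 'cV[R]_k) (heps : random_vector eps)
    (Q : 'M[R]_k) (hQ : symmetric_posdef Q)
    (W : 'M[R]_(k, m)) (hW : \rank W = m)
    (t : 'cV[R]_k -> 'cV[R]_m) (ht : borel_fun t)
    (ht2 : finite_second_moments P eps t)
    (muhat : 'cV[R]_k -> 'cV[R]_k) (hmuhat : Gamma P eps muhat) :
  forall mu : 'cV[R]_k,
    risk P eps Q mu (constrained_estimator Q W muhat t) =
    (risk1 P eps Q W mu muhat + risk2 P eps Q W mu t)%E.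
Proof.
move=> mu; case: hmuhat => mmuhat _.
have my := random_vector_shift mu heps.
rewrite /risk /risk1 /risk2 /cond_expectation.
under eq_fun do rewrite (loss_constrained_estimator hQ hW).
rewrite !unlock; under eq_integral do rewrite EFinD.
apply: ge0_integralD => //.
- by move=> w _; rewrite lee_fin quadratic_form_residual// quadratic_form_ge0.
- by apply/measurable_EFinP/measurable_quadratic_form/random_vector_comp.
- by move=> w _; rewrite lee_fin -quadratic_form_lift// quadratic_form_ge0.
- by apply/measurable_EFinP/measurable_quadratic_form/random_vector_comp.
Qed.
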